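(* Let $n\ge 1$, let $\mathcal{T}=(\mathbb{C}^* )^n$, and let $R:\mathcal{T}^2\to\mathcal{T}^2$ be the rational map $R(\mathbf{x},\mathbf{y})=(\mathbf{x}',\mathbf{y}')$ determined by $$x_1'\cdots x_k'=y_1\cdots y_k+\Delta_k(\mathbf{x},\mathbf{y})\,\eta(\mathbf{x},\mathbf{y})\quad (1\le k\le n),\qquad x_i'y_i'=x_iy_i\quad(1\le i\le n).$$ Then the reduced structure groups $G_R^+$ and $G_R^-$ of $(\mathcal{T},R)$ are (isomorphic to) subgroups of $PGL_n(\mathbb{C}(\lambda))$, where $\mathbb{C}(\lambda)$ is the field of rational functions in one variable $\lambda$. These subgroups are isomorphic to each other.
   Context: Elements of $\mathcal{T}=(\mathbb{C}^* )^n$ are written $\mathbf{t}=[t_1,\dots,t_n]$. For $\mathbf{x},\mathbf{y}\in\mathcal{T}$ set $\Delta_1=1$ and, for $k\ge 2$, $$\Delta_k(\mathbf{x},\mathbf{y})=x_1\cdots x_{k-1}+x_1\cdots x_{k-2}y_k+\dots+y_2\cdots y_k=\sum_{j=1}^k x_1\cdots x_{j-1}\,y_{j+1}\cdots y_k,$$ and $$\eta(\mathbf{x},\mathbf{y})=\frac{x_1\cdots x_n-y_1\cdots y_n}{\Delta_n(\mathbf{x},\mathbf{y})}.$$ The displayed conditions determine $R$ uniquely as a rational map, and they imply $\prod_i x_i'=\prod_i x_i$. Write $R(\mathbf{x},\mathbf{y})=(f_{\mathbf{y}}(\mathbf{x}),g_{\mathbf{x}}(\mathbf{y}))$. The map $R$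 is birational, is involutive ($R^{21}R=1$ with $R^{21}=PRP$, $P$ the permutation), satisfies the quantum Yang-Baxter equation $R_{12}R_{13}R_{23}=R_{23}R_{13}R_{12}$ on $\mathcal{T}^3$, and is nondegenerate, i.e. $f_{\mathbf{z}},g_{\mathbf{z}}$ are birational automorphisms of $\mathcal{T}$ for all $\mathbf{z}\in\mathcal{T}$. For an irreducible variety $Y$, $\mathrm{Bir}(Y)$ is the group of birational automorphisms of $Y$. Let $U\subset\mathcal{T}^2$ be the domain of definition of $R$ (the largest open set on which $R$ is regular). The structure group $G_R$ is the group generated by the points of $\mathcal{T}$ with defining relations $\mathbf{x}\mathbf{y}=\mathbf{y}'\mathbf{x}'$ whenever $(\mathbf{x},\mathbf{y})\in U$ and $R(\mathbf{x},\mathbf{y})=(\mathbf{x}',\mathbf{y}')$. It acts on $\mathcal{T}$ by birational transformations in two ways: $\mathbf{z}\mapsto f_{\mathbf{z}}^{-1}$ and $\mathbf{z}\mapsto g_{\mathbf{z}}$. The reduced structure groups are the images of $G_R$ in $\mathrm{Bir}(\mathcal{T})$ under these actions: $G_R^+$ is the image of the first action (the subgroup generated by all $f_{\mathbf{z}}^{-1}$, $\mathbf{z}\in\mathcal{T}$), and $G_R^-$ is the image of the second (the subgroup generated by all $g_{\mathbf{z}}$, $\mathbf{z}\in\mathcal{T}$). *)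

(* Defs.v *)
From HB Require Import structures.
From mathcomp Require Import all_boot all_algebra.
From mathcomp Require Import generic_quotient.
From mathcomp Require Import mpoly.
From mathcomp Require Import boolp classical_sets functions.
From mathcomp Require Import reals complex.

Set Implicit Arguments.
Unset Strict Implicit.
Unset Printing Implicit Defensive.

Import GRing.Theory.
Local Open Scope ring_scope.
Local Open Scope quotient_scope.

Local Notation "p %:F" := (@FracField.tofrac _ p) : ring_scope.

Notation ratfun C m := {fraction {mpoly C[m]}}.

(* A rational map from an m-dimensional to a k-dimensional torus (or affine
   space) is the tuple of its coordinates in the function field. *)
Notation ratmap C m k := {ffun 'I_k -> ratfun C m}.

Section Evaluation.
Variables (C L : fieldType) (iota : {rmorphism C -> L}) (m : nat).
Implicit Types (v : 'I_m -> L) (p q : {mpoly C[m]}) (r : ratfun C m).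

(* The value of r at the L-valued point v.  The value is p(v) / q(v) for any
   fraction p / q representing r with q(v) != 0; it does not depend on the
   choice (ratevalE), and it is 0 by convention when r is not regular at v. *)
Definition rateval v r : L :=
  xget 0 [set a | exists p q, [/\ mmap iota v q != 0, r = p%:F / q%:F
                                & a = mmap iota v p / mmap iota v q]].

Lemma ratevalE v p q : mmap iota v q != 0 ->
  rateval v (p%:F / q%:F) = mmap iota v p / mmap iota v q.
Proof.
move=> q_nz; rewrite /rateval; set S := (X in xget 0 X).
have [|p' [q' [q'_nz eq_pq ->]]] := @xgetPex _ 0 S.
  by exists (mmap iota v p / mmap iota v q), p, q.
have nz_of (s : {mpoly C[m]}) : mmap iota v s != 0 -> s%:F != 0.
  by apply: contra; rewrite tofrac_eq0 => /eqP ->; rewrite raddf0.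
move/eqP: eq_pq; rewrite eqr_div ?nz_of // -!tofracM tofrac_eq => /eqP eq_pq.
by apply/esym/eqP; rewrite eqr_div // -!rmorphM eq_pq.
Qed.

End Evaluation.

Section RationalMaps.
Variable C : fieldType.

Definition ratcst m : C -> ratfun C m := fun c => (c%:MP_[m])%:F.
HB.instance Definition _ m :=
  GRing.RMorphism.copy (@ratcst m) (@FracField.tofrac _ \o @mpolyC m C).

(* No nonzero polynomial vanishes on the image.  The coordinates of a dominant
   map are in particular nonzero, so it takes values in the torus. *)
Definition dominant m k (phi : ratmap C m k) :=
  forall p : {mpoly C[k]}, p != 0 -> mmap (@ratcst m) phi p != 0.

(* phi after psi *)
Definition ratcomp m k l (phi : ratmap C k l) (psi : ratmap C m k) :
    ratmap C m l :=
  [ffun i => rateval (@ratcst m) psi (phi i)].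

Definition ratid m : ratmap C m m := [ffun i => ('X_i)%:F].

Definition birational m (phi : ratmap C m m) :=
  dominant phi /\ exists psi : ratmap C m m,
    [/\ dominant psi, ratcomp phi psi = ratid m & ratcomp psi phi = ratid m].

Lemma frac_numden m (r : ratfun C m) :
  exists p q : {mpoly C[m]}, q != 0 /\ r = p%:F / q%:F.
Proof.
elim/quotW: r => x; exists x.1%N, x.2; split; first exact: denom_ratioP.
have xd := denom_ratioP x.
apply: (canRL (mulfK _)); first by rewrite tofrac_eq0.
rewrite !piE; apply/eqmodP; rewrite /= FracField.equivfE /=.
by rewrite /FracField.mulf !numden_Ratio ?oner_eq0 ?mulf_neq0 ?mulr1 ?oner_neq0 // mulrC.
Qed.

Section Dominant.
Variables (m k : nat) (phi : ratmap C m k) (dom_phi : dominant phi).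

Definition pullback & dominant phi := rateval (@ratcst m) phi.
Local Notation pb := (pullback dom_phi).

Lemma pullbackE p q : q != 0 ->
  pb (p%:F / q%:F) = mmap (@ratcst m) phi p / mmap (@ratcst m) phi q.
Proof. by move=> /dom_phi; exact: ratevalE. Qed.

Lemma pullback_poly p : pb p%:F = mmap (@ratcst m) phi p.
Proof.
by rewrite -[p%:F]divr1 -tofrac1 pullbackE ?oner_neq0 // rmorph1 divr1.
Qed.

Lemma pullback_zmod_morphism : zmod_morphism pb.
Proof.
move=> r s; have [p [q [q0 ->]]] := frac_numden r.
have [p' [q' [q'0 ->]]] := frac_numden s.
rewrite -mulNr addf_div ?tofrac_eq0 // -tofracN -!tofracM -tofracD.
rewrite !pullbackE ?mulf_neq0 // -mulNr addf_div ?dom_phi //.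
by rewrite !rmorphD !rmorphM !rmorphN.
Qed.

Lemma pullback_monoid_morphism : monoid_morphism pb.
Proof.
split=> [|r s]; first by rewrite -tofrac1 pullback_poly rmorph1.
have [p [q [q0 ->]]] := frac_numden r.
have [p' [q' [q'0 ->]]] := frac_numden s.
rewrite mulf_div -!tofracM !pullbackE ?mulf_neq0 //.
by rewrite mulf_div !rmorphM.
Qed.

HB.instance Definition _ :=
  GRing.isZmodMorphism.Build _ _ pb pullback_zmod_morphism.
HB.instance Definition _ :=
  GRing.isMonoidMorphism.Build _ _ pb pullback_monoid_morphism.

Lemma mmap_ratcomp l (psi : ratmap C k l) p :
  mmap (@ratcst m) (ratcomp psi phi) p = pb (mmap (@ratcst k) psi p).
Proof.
rewrite /mmap rmorph_sum; apply: eq_bigr => a _.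
rewrite rmorphM rmorph_prod /= /ratcst pullback_poly mmapC; congr (_ * _).
by apply: eq_bigr => i _; rewrite rmorphXn /= ffunE.
Qed.

Lemma dominant_ratcomp l (psi : ratmap C k l) :
  dominant psi -> dominant (ratcomp psi phi).
Proof. by move=> dom_psi p /dom_psi; rewrite mmap_ratcomp fmorph_eq0. Qed.

End Dominant.

Lemma ratcompA m k l o (phi : ratmap C l o) (psi : ratmap C k l)
    (chi : ratmap C m k) : dominant psi -> dominant chi ->
  ratcomp phi (ratcomp psi chi) = ratcomp (ratcomp phi psi) chi.
Proof.
move=> dpsi dchi; apply/ffunP => i; rewrite !ffunE.
have [p [q [q0 ->]]] := frac_numden (phi i).
have dcomp := dominant_ratcomp dchi dpsi.
rewrite -/(pullback dcomp _) -/(pullback dpsi _) -/(pullback dchi _).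
by rewrite !pullbackE // fmorph_div /= -!mmap_ratcomp.
Qed.

Lemma mmap_ratid m (p : {mpoly C[m]}) : mmap (@ratcst m) (ratid m) p = p%:F.
Proof.
rewrite [p in RHS]mpolyE rmorph_sum; apply: eq_bigr => a _.
rewrite -mul_mpolyC rmorphM; congr (_ * _).
rewrite mpolyXE_id rmorph_prod; apply: eq_bigr => i _.
by rewrite ffunE rmorphXn.
Qed.

Lemma dominant_ratid m : dominant (ratid m).
Proof. by move=> p p0; rewrite mmap_ratid tofrac_eq0. Qed.

Lemma ratcomp1m m k (phi : ratmap C m k) :
  dominant phi -> ratcomp (ratid k) phi = phi.
Proof.
move=> dphi; apply/ffunP => i; rewrite !ffunE -/(pullback dphi _).
by rewrite pullback_poly mmapX mmap1U.
Qed.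

Lemma ratcompm1 m k (phi : ratmap C m k) : ratcomp phi (ratid m) = phi.
Proof.
apply/ffunP => i; rewrite !ffunE.
have [p [q [q0 ->]]] := frac_numden (phi i).
by rewrite -/(pullback (@dominant_ratid m) _) pullbackE // !mmap_ratid.
Qed.

Variable n : nat.

(* The group of birational automorphisms of the n-dimensional torus over C. *)
Record Bir := MkBir {
  bir_map :> ratmap C n n;
  bir_mapP : `[< birational bir_map >]
}.
HB.instance Definition _ := [isSub for bir_map].
HB.instance Definition _ := [Choice of Bir by <:].

Lemma bir_dominant (f : Bir) : dominant f.
Proof. by case: f => phi /= /asboolP []. Qed.

Lemma birational_comp (f g : Bir) : birational (ratcomp f g).
Proof.
have [/asboolP [df [f' [df' ff' f'f]]] /asboolP [dg [g' [dg' gg' g'g]]]] :=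
  (bir_mapP f, bir_mapP g).
split; first exact: dominant_ratcomp.
exists (ratcomp g' f'); split; first exact: dominant_ratcomp.
- rewrite -(ratcompA f dg (dominant_ratcomp df' dg')) (ratcompA g dg' df').
  by rewrite gg' ratcomp1m.
- rewrite -(ratcompA g' df' (dominant_ratcomp dg df)) (ratcompA f' df dg).
  by rewrite f'f ratcomp1m.
Qed.

Lemma birational_id : birational (ratid n).
Proof.
split; first exact: dominant_ratid.
by exists (ratid n); split; rewrite ?ratcompm1 //; exact: dominant_ratid.
Qed.

Lemma bir_inv_subproof (f : Bir) : exists g : Bir,
  ratcomp f g = ratid n /\ ratcomp g f = ratid n.
Proof.
have /asboolP [df [f' [df' ff' f'f]]] := bir_mapP f.
have f'P : `[< birational f' >] by apply/asboolP; split=> //; exists f.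
by exists (MkBir f'P).
Qed.

Definition bir_mul (f g : Bir) : Bir := MkBir (asboolT (birational_comp f g)).
Definition bir_one : Bir := MkBir (asboolT birational_id).
Definition bir_inv (f : Bir) : Bir := sval (cid (bir_inv_subproof f)).

Lemma bir_mulA : associative bir_mul.
Proof.
by move=> f g h; apply: val_inj; apply: ratcompA; exact: bir_dominant.
Qed.

Lemma bir_mul1 : left_id bir_one bir_mul.
Proof. by move=> f; apply/val_inj/ratcomp1m; exact: bir_dominant. Qed.

Lemma bir_mul1r : right_id bir_one bir_mul.
Proof. by move=> f; apply/val_inj/ratcompm1. Qed.

Lemma bir_mulV : left_inverse bir_one bir_inv bir_mul.
Proof. by move=> f; apply: val_inj; rewrite /= /bir_inv; case: cid => g []. Qed.

Lemma bir_mulVr : right_inverse bir_one bir_inv bir_mul.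
Proof. by move=> f; apply: val_inj; rewrite /= /bir_inv; case: cid => g []. Qed.

HB.instance Definition _ :=
  isGroup.Build Bir bir_mulA bir_mul1 bir_mul1r bir_mulV bir_mulVr.

End RationalMaps.

Section PGL.
Variables (F : fieldType) (n : nat).

Record GL := MkGL { GL_mx :> 'M[F]_n; GL_unit : GL_mx \in unitmx }.
HB.instance Definition _ := [isSub for GL_mx].
HB.instance Definition _ := [Choice of GL by <:].

Lemma GL_mul_subproof (A B : GL) : A *m B \in unitmx.
Proof. by rewrite unitmx_mul !GL_unit. Qed.
Lemma GL_inv_subproof (A : GL) : invmx A \in unitmx.
Proof. by rewrite unitmx_inv GL_unit. Qed.

Definition GL_mul (A B : GL) : GL := MkGL (GL_mul_subproof A B).
Definition GL_one : GL := MkGL (unitmx1 F n).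
Definition GL_inv (A : GL) : GL := MkGL (GL_inv_subproof A).

Lemma GL_mulA : associative GL_mul.
Proof. by move=> A B D; apply/val_inj/mulmxA. Qed.
Lemma GL_mul1 : left_id GL_one GL_mul.
Proof. by move=> A; apply/val_inj/mul1mx. Qed.
Lemma GL_mul1r : right_id GL_one GL_mul.
Proof. by move=> A; apply/val_inj/mulmx1. Qed.
Lemma GL_mulV : left_inverse GL_one GL_inv GL_mul.
Proof. by move=> A; apply/val_inj/mulVmx/GL_unit. Qed.
Lemma GL_mulVr : right_inverse GL_one GL_inv GL_mul.
Proof. by move=> A; apply/val_inj/mulmxV/GL_unit. Qed.

HB.instance Definition _ :=
  isGroup.Build GL GL_mulA GL_mul1 GL_mul1r GL_mulV GL_mulVr.

Definition proportional (A B : GL) : bool :=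
  `[< exists2 c : F, c != 0 & GL_mx A = c *: GL_mx B >].

Lemma proportional_refl : reflexive proportional.
Proof. by move=> A; apply/asboolP; exists 1; rewrite ?oner_neq0 ?scale1r. Qed.

Lemma proportional_sym : ssrbool.symmetric proportional.
Proof.
suff sub A B : proportional A B -> proportional B A.
  by move=> A B; apply/idP/idP; exact: sub.
move=> /asboolP [c c0 AB]; apply/asboolP; exists c^-1; first by rewrite invr_eq0.
by rewrite AB scalerA mulVf // scale1r.
Qed.

Lemma proportional_trans : transitive proportional.
Proof.
move=> B A D /asboolP [c c0 AB] /asboolP [d d0 BD]; apply/asboolP.
by exists (c * d); rewrite ?mulf_neq0 // AB BD scalerA.
Qed.

Canonical proportional_equiv := EquivRel proportional
  proportional_refl proportional_sym proportional_trans.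

Definition PGL := {eq_quot proportional}.
HB.instance Definition _ : EqQuotient _ proportional PGL := EqQuotient.on PGL.
HB.instance Definition _ := Choice.on PGL.

Definition PGL_mul : PGL -> PGL -> PGL := lift_op2 PGL GL_mul.
Definition PGL_one : PGL := \pi_PGL GL_one.
Definition PGL_inv : PGL -> PGL := lift_op1 PGL GL_inv.

Lemma pi_PGL_mul : {morph \pi_PGL : A B / GL_mul A B >-> PGL_mul A B}.
Proof.
move=> A B; unlock PGL_mul; apply/eqmodP/asboolP.
have /eqmodP/asboolP [c c0 Ac] : A = repr (\pi_PGL A) %[mod PGL] by rewrite reprK.
have /eqmodP/asboolP [d d0 Bd] : B = repr (\pi_PGL B) %[mod PGL] by rewrite reprK.
exists (c * d); first exact: mulf_neq0.
by rewrite /= Ac Bd -scalemxAl -scalemxAr scalerA.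
Qed.

Lemma pi_PGL_inv : {morph \pi_PGL : A / GL_inv A >-> PGL_inv A}.
Proof.
move=> A; unlock PGL_inv; apply/eqmodP/asboolP.
have /eqmodP/asboolP [c c0 Ac] : A = repr (\pi_PGL A) %[mod PGL] by rewrite reprK.
exists c^-1; first by rewrite invr_eq0.
by rewrite /= Ac invmxZ ?unitmxZ ?unitfE ?GL_unit.
Qed.

Lemma PGL_mulA : associative PGL_mul.
Proof.
elim/quotW=> A; elim/quotW=> B; elim/quotW=> D.
by rewrite -!pi_PGL_mul GL_mulA.
Qed.
Lemma PGL_mul1 : left_id PGL_one PGL_mul.
Proof. by elim/quotW=> A; rewrite -pi_PGL_mul GL_mul1. Qed.
Lemma PGL_mul1r : right_id PGL_one PGL_mul.
Proof. by elim/quotW=> A; rewrite -pi_PGL_mul GL_mul1r. Qed.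
Lemma PGL_mulV : left_inverse PGL_one PGL_inv PGL_mul.
Proof. by elim/quotW=> A; rewrite -pi_PGL_inv -pi_PGL_mul GL_mulV. Qed.
Lemma PGL_mulVr : right_inverse PGL_one PGL_inv PGL_mul.
Proof. by elim/quotW=> A; rewrite -pi_PGL_inv -pi_PGL_mul GL_mulVr. Qed.

HB.instance Definition _ :=
  isGroup.Build PGL PGL_mulA PGL_mul1 PGL_mul1r PGL_mulV PGL_mulVr.

End PGL.

Section Subgroups.
Local Open Scope classical_set_scope.
Local Open Scope group_scope.

Definition subgroup (G : groupType) (A : set G) := group_closed (mem A).

Definition generated (G : groupType) (A : set G) : set G :=
  smallest (@subgroup G) A.

Definition isomorphic (G H : groupType) (A : set G) (B : set H) :=
  exists2 f : G -> H, set_bij A B f &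
    {in A &, {morph f : x y / x * y}}.

End Subgroups.

Section ReducedStructureGroups.
Variables (C : fieldType) (n : nat).

Definition torus : set ('I_n -> C) := [set z | forall i, z i != 0].

(* Indices start at 0 here: the summand x_1 ... x_(j-1) y_(j+1) ... y_k is the
   one of index j-1. *)
Definition Delta (F : fieldType) (k : nat) (x y : 'I_n -> F) : F :=
  \sum_(j < n | (j < k)%N)
     (\prod_(i < n | (i < j)%N) x i) * (\prod_(i < n | (j < i < k)%N) y i).

Definition eta (F : fieldType) (x y : 'I_n -> F) : F :=
  (\prod_i x i - \prod_i y i) / Delta n x y.

(* The equations defining the rational map R : (x, y) |-> (x', y'), in the
   field C(x_1, ..., x_n, y_1, ..., y_n). *)
Definition R_spec (R : ratmap C (n + n) (n + n)) : Prop :=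
  let x i : ratfun C (n + n) := ('X_(lshift n i))%:F in
  let y i : ratfun C (n + n) := ('X_(rshift n i))%:F in
  let x' i := R (lshift n i) in
  let y' i := R (rshift n i) in
  (forall k : nat, (1 <= k <= n)%N ->
     \prod_(i < n | (i < k)%N) x' i =
     \prod_(i < n | (i < k)%N) y i + Delta k x y * eta x y) /\
  (forall i : 'I_n, x' i * y' i = x i * y i).

Definition pair_point (F : Type) (u v : 'I_n -> F) : 'I_(n + n) -> F :=
  fun i => match fintype.split i with inl j => u j | inr j => v j end.

Variable R : ratmap C (n + n) (n + n).

(* R(x, y) = (f_y(x), g_x(y)): R is evaluated at the point of the square of the
   torus, over the function field, with one entry the constant point z and the
   other one the generic point. *)
Definition R_f (z : 'I_n -> C) : ratmap C n n :=
  [ffun i => rateval (@ratcst C n)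
     (pair_point (ratid C n) (fun j => ratcst n (z j))) (R (lshift n i))].

Definition R_g (z : 'I_n -> C) : ratmap C n n :=
  [ffun i => rateval (@ratcst C n)
     (pair_point (fun j => ratcst n (z j)) (ratid C n)) (R (rshift n i))].

(* For the map R determined by R_spec, all R_f z and R_g z with z in the torus
   are birational, so every z contributes a generator. *)
Definition reduced_plus : set (Bir C n) :=
  generated [set (b^-1)%g | b in [set b : Bir C n |
    exists2 z, torus z & bir_map b = R_f z]].

Definition reduced_minus : set (Bir C n) :=
  generated [set b : Bir C n | exists2 z, torus z & bir_map b = R_g z].

End ReducedStructureGroups.

(* Main.v *)
Require Import Defs.
From HB Require Import structures.
From mathcomp Require Import all_boot all_algebra perm.
From mathcomp Require Import generic_quotient.
From mathcomp Require Import mpoly.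
From mathcomp Require Import ring zify.
From mathcomp Require Import boolp classical_sets functions.
From mathcomp Require Import reals complex.

Set Implicit Arguments.
Unset Strict Implicit.
Unset Printing Implicit Defensive.

Import GRing.Theory.
Local Open Scope ring_scope.
Local Open Scope quotient_scope.

Local Notation "p %:F" := (@FracField.tofrac _ p) : ring_scope.

(** Why the theorem is true.  For a point z of the torus and a scalar t let
    L_z(t) be the matrix diag(z) - S(t), where S(t) is the cyclic shift with
    one entry replaced by t: (S(t) u)_k = u_(k+1), where the entries of a
    vector are u_0, ..., u_(n-1) and u_n stands for t u_0.  A point x of the
    torus is the same thing as the pair formed by t = x_1...x_n and the kernel
    line of L_x(t), which is spanned by
    v(x) = (1, x_1, x_1 x_2, ..., x_1...x_(n-1)).

    The defining equations of R say that the vector v(x'), rescaled to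
    polynomial entries P_k, satisfies
    P_(k+1) = y_(k+1) P_k + (t - y_1...y_n) v_k, where v = v(x); that is,
    L_y(t) v(x') is proportional to v(x) (numerator_lax).  Moreover x' and x
    have the same t.  Hence, in the coordinates (t, v), the map f_z is the
    projective transformation L_z(t)^-1, a matrix over C(t) (R_f_acts).  The
    birational maps which are given, in these coordinates, by a matrix over
    C(t) form a group, and sending such a map to its matrix is an injective
    morphism to PGL_n(C(t)): the map is determined by the matrix because x is
    recovered from (t, v), and the matrix is determined up to a scalar because
    v is generic, so that a matrix over C(t) having v as an eigenvector is
    scalar (kernel_vec_generic).  Restricted to G^+, this morphism embeds it
    in PGL_n(C(t)).

    For G^-, let rho reverse the order of the coordinates.  Transposing L_z
    along the antidiagonal gives L_(rho z), and this symmetry turns the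
    equations for g_z into those for f: one has g_z = rho f_(rho z) rho
    (R_g_reversal).  So G^- is the conjugate of G^+ by the birational
    involution rho, and both groups are isomorphic to the same subgroup of
    PGL_n(C(t)). *)

(** * The equations of R over a commutative ring *)

Section PartialProducts.
Variables (A : comNzRingType) (n : nat).
Implicit Types x y : 'I_n -> A.

Definition prefix_prod x k : A := \prod_(i < n | (i < k)%N) x i.

(** The sum Delta over any commutative ring.  The values of R at points are
    computed from fractions of polynomials, and polynomials do not form a
    field. *)
Definition deltaR k x y : A :=
  \sum_(j < n | (j < k)%N)
     (\prod_(i < n | (i < j)%N) x i) * (\prod_(i < n | (j < i < k)%N) y i).

(** Clearing the denominator of eta: x'_1...x'_k is
    numerator k x y / Delta_n, and Delta_n = numerator 0 x y. *)
Definition numerator k x y : A :=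
  prefix_prod y k * deltaR n x y + deltaR k x y * (\prod_i x i - \prod_i y i).

Definition reversed x : 'I_n -> A := x \o @rev_ord n.

Lemma reversed_rev_ord x i : reversed x (rev_ord i) = x i.
Proof. by rewrite /reversed /= rev_ordK. Qed.

Lemma prefix_prod0 x : prefix_prod x 0 = 1.
Proof. by rewrite /prefix_prod big_pred0. Qed.

Lemma prefix_prodn x : prefix_prod x n = \prod_i x i.
Proof. by apply: eq_bigl => i; rewrite ltn_ord. Qed.

Lemma prefix_prodS x (i : 'I_n) : prefix_prod x i.+1 = prefix_prod x i * x i.
Proof.
rewrite /prefix_prod (bigD1 i) ?ltnSn //= mulrC; congr (_ * _).
by apply: eq_bigl => j; rewrite ltnS andbC -val_eqE ltn_neqAle.
Qed.

Lemma deltaR0 x y : deltaR 0 x y = 0.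
Proof. by rewrite /deltaR big_pred0. Qed.

Lemma deltaRS x y (i : 'I_n) :
  deltaR i.+1 x y = deltaR i x y * y i + prefix_prod x i.
Proof.
rewrite /deltaR (bigD1 i) ?ltnSn //= addrC; congr (_ + _); last first.
  rewrite [X in _ * X]big_pred0 ?mulr1 // => j.
  by rewrite ltnS; case: ltngtP.
have lt_i (j : 'I_n) : ((j < i.+1) && (j != i))%N = (j < i)%N.
  by rewrite ltnS andbC -val_eqE ltn_neqAle.
rewrite mulr_suml; apply: eq_big => // j; rewrite lt_i => ji.
rewrite -mulrA [X in _ = _ * X]mulrC; congr (_ * _).
rewrite (bigD1 i) ?ltnSn ?ji //=; congr (_ * _).
by apply: eq_bigl => m; rewrite -andbA lt_i.
Qed.

Lemma numerator0 x y : numerator 0 x y = deltaR n x y.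
Proof. by rewrite /numerator prefix_prod0 deltaR0 mul1r mul0r addr0. Qed.

Lemma numeratorn x y : numerator n x y = deltaR n x y * \prod_i x i.
Proof. by rewrite /numerator prefix_prodn; ring. Qed.

(** The recursion y_(k+1) Delta_k - Delta_(k+1) = - x_1...x_k, which makes
    the numerators a solution of a linear system with cyclic matrix. *)
Lemma numeratorS x y (i : 'I_n) :
  numerator i.+1 x y =
  numerator i x y * y i + prefix_prod x i * (\prod_i x i - \prod_i y i).
Proof. by rewrite /numerator deltaRS prefix_prodS; ring. Qed.

Lemma prefix_prod_rev x k : (k <= n)%N ->
  prefix_prod x k * prefix_prod (reversed x) (n - k) = \prod_i x i.
Proof.
move=> kn; rewrite [RHS](bigID (fun i : 'I_n => (i < k)%N)) /=; congr (_ * _).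
rewrite /prefix_prod (reindex_inj rev_ord_inj) /=.
apply: eq_big => [i|i _]; last by rewrite /reversed /= rev_ordK.
by have ? := ltn_ord i; rewrite -leqNgt; apply/idP/idP; lia.
Qed.

Lemma prod_rev x : \prod_i reversed x i = \prod_i x i.
Proof.
rewrite -(prefix_prod_rev x (leq0n n)) prefix_prod0 mul1r subn0.
by rewrite prefix_prodn.
Qed.

Lemma deltaR_rev x y : deltaR n (reversed y) (reversed x) = deltaR n x y.
Proof.
rewrite /deltaR (reindex_inj rev_ord_inj) /=.
apply: eq_big => [j|j _]; first by rewrite (ltn_ord (rev_ord j)) ltn_ord.
rewrite mulrC; congr (_ * _); rewrite (reindex_inj rev_ord_inj) /=;
  apply: eq_big => [i|i _]; rewrite /reversed /= ?rev_ordK //;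
  by have ? := ltn_ord i; have ? := ltn_ord j; rewrite ?ltn_ord ?andbT;
     apply/idP/idP; lia.
Qed.

(** The identity behind g_z = rho f_(rho z) rho.  The numerators at (x, y),
    divided by x_1...x_k y_1...y_k, satisfy the same recursion as those at the
    reversed pair, run backwards. *)
Lemma numerator_rev x y k : (k <= n)%N ->
  numerator (n - k) (reversed y) (reversed x)
    * prefix_prod x k * prefix_prod y k =
  numerator k x y * \prod_i y i.
Proof.
elim: k => [|k IHk] kn.
  rewrite subn0 numeratorn deltaR_rev prod_rev numerator0 !prefix_prod0.
  by rewrite !mulr1.
pose i := Ordinal kn; have ki : k = i by [].
have := IHk (ltnW kn); have Ek : (n - k = (rev_ord i).+1)%N by rewrite /=; lia.
rewrite Ek numeratorS !prod_rev reversed_rev_ord => E.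
have Py := prefix_prod_rev y kn.
rewrite [in prefix_prod _ _]ki prefix_prodS -ki in Py.
rewrite [in numerator k.+1 _ _]ki numeratorS ![in prefix_prod _ k.+1]ki.
rewrite !prefix_prodS -ki /=.
transitivity (numerator k x y * (\prod_j y j) * y i
  + prefix_prod x k * (\prod_j x j - \prod_j y j) * \prod_j y j); last by ring.
by rewrite -E -Py /=; ring.
Qed.

End PartialProducts.

Lemma prefix_prod_rmorph (A B : comNzRingType) (h : {rmorphism A -> B}) n k
    (x : 'I_n -> A) : h (prefix_prod x k) = prefix_prod (h \o x) k.
Proof. exact: rmorph_prod. Qed.

Lemma deltaR_rmorph (A B : comNzRingType) (h : {rmorphism A -> B}) n k
    (x y : 'I_n -> A) : h (deltaR k x y) = deltaR k (h \o x) (h \o y).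
Proof.
rewrite rmorph_sum; apply: eq_bigr => j _.
by rewrite rmorphM !rmorph_prod.
Qed.

Lemma numerator_rmorph (A B : comNzRingType) (h : {rmorphism A -> B}) n k
    (x y : 'I_n -> A) : h (numerator k x y) = numerator k (h \o x) (h \o y).
Proof.
rewrite rmorphD !rmorphM rmorphB !deltaR_rmorph prefix_prod_rmorph.
by rewrite !rmorph_prod.
Qed.

Lemma prefix_prod_neq0 (A : idomainType) n (x : 'I_n -> A) k :
  (forall i, x i != 0) -> prefix_prod x k != 0.
Proof. by move=> nz; apply/prodf_neq0 => i _. Qed.

(** Putting x_k = 0 kills x_1...x_n, hence numerator n, and the recursion then
    kills all the numerators after the k-th; going back one more step leaves
    numerator k x y * y_k = y_1...y_n. *)
Lemma numerator_neq0 (A : idomainType) n (x y : 'I_n -> A) (k : 'I_n) :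
    (forall i, y i != 0) -> (forall i, x i = (i != k)%:R) ->
  numerator k x y != 0.
Proof.
move=> nz_y x_k.
have prod_x : \prod_i x i = 0 by rewrite (bigD1 k) //= x_k eqxx mul0r.
have x_gt j : (k < j)%N -> prefix_prod x j = 0.
  by move=> kj; rewrite /prefix_prod (bigD1 k) //= x_k eqxx mul0r.
have numerator_gt d j : (j + d = n)%N -> (k < j)%N -> numerator j x y = 0.
  elim: d j => [|d IHd] j.
    by rewrite addn0 => -> _; rewrite numeratorn prod_x mulr0.
  move=> jd kj; have jn : (j < n)%N by lia.
  have := numeratorS x y (Ordinal jn).
  rewrite /= IHd ?x_gt ?mul0r ?addr0; try lia.
  by move/esym/eqP; rewrite mulf_eq0 (negPf (nz_y _)) orbF => /eqP.
have := numeratorS x y k; rewrite (numerator_gt (n - k.+1)%N) //; last first.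
  by have := ltn_ord k; lia.
have -> : prefix_prod x k = 1.
  by apply: big1 => i ik; rewrite x_k -val_eqE ltn_eqF.
rewrite prod_x sub0r mul1r => /esym/eqP; rewrite subr_eq0.
apply: contraTneq => ->; rewrite mul0r eq_sym.
by apply/prodf_neq0 => i _.
Qed.

(** The coordinates (t, v) generate the function field: x_i = v_(i+1) / v_i,
    where v_n = t. *)
Lemma eq_rmorph_prefix (K E : fieldType) n (x : 'I_n -> K)
    (h g : {rmorphism K -> E}) :
    (forall i, x i != 0) -> h (\prod_i x i) = g (\prod_i x i) ->
    map_mx h (\col_(k < n) prefix_prod x k) =
    map_mx g (\col_(k < n) prefix_prod x k) ->
  forall i, h (x i) = g (x i).
Proof.
move=> x_nz hg_n hg i.
have hg_k k : (k <= n)%N -> h (prefix_prod x k) = g (prefix_prod x k).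
  rewrite leq_eqVlt => /orP[/eqP ->|kn]; first by rewrite prefix_prodn.
  by have /colP/(_ (Ordinal kn)) := hg; rewrite !mxE.
have -> : x i = prefix_prod x i.+1 / prefix_prod x i.
  by rewrite prefix_prodS mulrC mulKf // prefix_prod_neq0.
by rewrite !fmorph_div !hg_k // ltnW.
Qed.

(** * Cyclic matrices and generic eigenvectors *)

Lemma prefix_prod_quotients (F : fieldType) n (u : nat -> F) k :
    (forall i, (i < n)%N -> u i != 0) -> u 0 != 0 -> (k <= n)%N ->
  prefix_prod (fun i : 'I_n => u i.+1 / u i) k = u k / u 0.
Proof.
move=> u_nz u0; elim: k => [|k IHk] kn; first by rewrite prefix_prod0 divff.
rewrite (prefix_prodS _ (Ordinal kn)) /= IHk ?(ltnW kn) //.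
by have := u_nz k kn => uk; field; rewrite uk u0.
Qed.

(** The vectors with nonzero entries are enough to see that a matrix with many
    eigenvectors is scalar: the all-one vector shows that all the row sums are
    equal, and 1 + r e_k gives an equation for M_ik which is affine in r, so
    that two values of r force M_ik = 0. *)
Lemma scalar_mx_of_eigenvectors (F : fieldType) n (M : 'M[F]_n) (s t : F) :
    s != 0 -> t != 0 -> s != t -> 1 + s != 0 -> 1 + t != 0 ->
    (forall c : 'cV[F]_n, (forall i, c i 0 != 0) ->
     forall i j, (M *m c) i 0 * c j 0 = (M *m c) j 0 * c i 0) ->
  is_scalar_mx M.
Proof.
move=> s0 t0 st s1 t1 eigM.
have row_sum i j : \sum_k M i k = \sum_k M j k.
  have e i' : (M *m const_mx 1 : 'cV_n) i' 0 = \sum_k M i' k.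
    by rewrite !mxE; apply: eq_bigr => k _; rewrite mxE mulr1.
  have nz i' : (const_mx 1 : 'cV[F]_n) i' 0 != 0 by rewrite mxE oner_neq0.
  by have := eigM _ nz i j; rewrite !e !mxE !mulr1.
have off r i k : r != 0 -> 1 + r != 0 -> i != k ->
    M i k * (1 + r) = M k k - \sum_j M k j.
  move=> r0 r1 ik; pose c : 'cV[F]_n := \col_j (1 + r * (j == k)%:R).
  have cnz j : c j 0 != 0.
    rewrite mxE; have [_|_] := eqVneq j k; first by rewrite mulr1n mulr1.
    by rewrite mulr0n mulr0 addr0 oner_neq0.
  have e j : (M *m c) j 0 = \sum_m M k m + r * M j k.
    rewrite mxE (row_sum k j); under eq_bigr do rewrite mxE mulrDr mulr1.
    rewrite big_split /=; congr (_ + _).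
    rewrite (bigD1 k) //= eqxx big1 => [|m /negPf ->]; last first.
      by rewrite mulr0n !mulr0.
    by rewrite addr0 mulr1n mulr1 mulrC.
  have := eigM c cnz i k; rewrite !e !mxE eqxx (negPf ik).
  rewrite mulr1n mulr0n mulr1 mulr0 addr0 mulr1; set S := \sum_j _ => E.
  apply: (mulfI r0).
  transitivity ((S + r * M i k) * (1 + r) - S * (1 + r)); first by ring.
  by rewrite E; ring.
have M0 i k : i != k -> M i k = 0.
  move=> ik; have := off s i k s0 s1 ik; rewrite -(off t i k t0 t1 ik) => /eqP.
  rewrite -subr_eq0 -mulrBr mulf_eq0 => /orP[/eqP//|].
  by rewrite opprD addrACA subrr add0r subr_eq0 (negPf st).
case: n => [|n] in M eigM row_sum off M0 *.
  by apply/is_scalar_mxP; exists 0; apply/matrixP => -[].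
apply/is_scalar_mxP; exists (M 0 0); apply/matrixP => i j; rewrite mxE.
have diag k : \sum_m M k m = M k k.
  by rewrite (bigD1 k) //= big1 ?addr0 // => m mk; rewrite M0 // eq_sym.
have [<-|ij] := eqVneq i j; last by rewrite mulr0n M0.
by rewrite mulr1n -!diag (row_sum i 0).
Qed.

Section LaxMatrix.
Variables (F : fieldType) (n : nat).

(** The matrix diag(z) - S(t).  For n = 1 the diagonal and the corner entry t
    fall on the same place, hence a sum instead of a case distinction. *)
Definition lax_mx (t : F) (z : 'I_n -> F) : 'M[F]_n :=
  \matrix_(i, j) (z i *+ (i == j) - (j == i.+1 :> nat)%:R
                  - t *+ ((i.+1 == n) && (j == 0 :> nat))).

Lemma lax_mx_mul t z (u : nat -> F) (i : 'I_n) : u n = t * u 0 ->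
  (lax_mx t z *m (\col_(j < n) u j)) i 0 = z i * u i - u i.+1.
Proof.
move=> un; rewrite mxE; under eq_bigr do rewrite !mxE !mulrBl.
have n_gt0 : (0 < n)%N by apply: leq_ltn_trans (ltn_ord i).
rewrite !sumrB -addrA -opprD; congr (_ - _).
  rewrite (bigD1 i) //= eqxx big1 ?addr0 // => j.
  by rewrite eq_sym => /negPf ->; rewrite mul0r.
have [i_last|i_n] := eqVneq i.+1 n.
  rewrite big1 => [|j _]; last by rewrite i_last ltn_eqF ?ltn_ord // mul0r.
  rewrite (bigD1 (Ordinal n_gt0)) //= big1 ?addr0 => [|j].
    by rewrite add0r i_last un.
  by rewrite -val_eqE /= => /negPf ->; rewrite mulr0n mul0r.
have i1n : (i.+1 < n)%N by rewrite ltn_neqAle i_n ltn_ord.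
rewrite (bigD1 (Ordinal i1n)) //= eqxx mul1r [X in _ + _ + X]big1 ?addr0.
  rewrite big1 ?addr0 // => j; rewrite -val_eqE /= => /negPf ->.
  by rewrite mul0r.
by move=> j _; rewrite mulr0n mul0r.
Qed.

Definition cyclic_ext (n_gt0 : (0 < n)%N) (t : F) (c : 'I_n -> F) k : F :=
  if insub k is Some i then c i else t * c (Ordinal n_gt0).

Lemma cyclic_ext_ord n_gt0 t c (i : 'I_n) : cyclic_ext n_gt0 t c i = c i.
Proof. by rewrite /cyclic_ext valK. Qed.

Lemma cyclic_ext0 n_gt0 t c : cyclic_ext n_gt0 t c 0 = c (Ordinal n_gt0).
Proof. exact: (cyclic_ext_ord n_gt0 t c (Ordinal n_gt0)). Qed.

Lemma cyclic_extn n_gt0 t c :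
  cyclic_ext n_gt0 t c n = t * cyclic_ext n_gt0 t c 0.
Proof. by rewrite cyclic_ext0 /cyclic_ext insubN // ltnn. Qed.

(** The determinant is z_1...z_n - t.  Invertibility is read off the kernel: a
    vector of the kernel is (1, z_1, z_1 z_2, ...) times its first entry, and
    closing the cycle requires t = z_1...z_n. *)
Lemma lax_mx_unit t z : (0 < n)%N -> t != \prod_i z i -> lax_mx t z \in unitmx.
Proof.
move=> n_gt0 tz; rewrite -unitmx_tr -row_free_unit -kermx_eq0.
apply/rowV0P => w /sub_kermxP /(congr1 trmx).
rewrite trmx_mul trmxK trmx0 => Lw.
pose u := cyclic_ext n_gt0 t (w 0).
have un : u n = t * u 0 := cyclic_extn n_gt0 t (w 0).
have ui (i : 'I_n) : u i = w 0 i by rewrite /u cyclic_ext_ord.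
have ucol : \col_(j < n) u j = w^T by apply/colP => j; rewrite !mxE ui.
have uS (i : 'I_n) : u i.+1 = z i * u i.
  apply/esym/eqP; rewrite -subr_eq0 -(lax_mx_mul _ _ un) ucol Lw.
  by rewrite mxE.
have uk k : (k <= n)%N -> u k = prefix_prod z k * u 0.
  elim: k => [|k IHk] kn; first by rewrite prefix_prod0 mul1r.
  rewrite (uS (Ordinal kn)) (prefix_prodS _ (Ordinal kn)) /= IHk ?(ltnW kn) //.
  by rewrite mulrCA mulrA.
have u00 : u 0 = 0.
  have /eqP := uk n (leqnn n).
  rewrite un prefix_prodn -subr_eq0 -mulrBl mulf_eq0.
  by rewrite subr_eq0 (negPf tz) => /eqP.
by apply/rowP => j; rewrite !mxE -ui uk 1?ltnW // u00 mulr0.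
Qed.

End LaxMatrix.

Lemma map_lax_mx (F E : fieldType) (h : {rmorphism F -> E}) n t
    (z : 'I_n -> F) :
  map_mx h (lax_mx t z) = lax_mx (h t) (h \o z).
Proof.
by apply/matrixP => i j; rewrite !mxE !rmorphB /= !rmorphMn rmorph1.
Qed.

(** The matrix of y at t = x_1...x_n sends the kernel line of x' to the kernel
    line of x. *)
Lemma numerator_lax (F : fieldType) n (x y : 'I_n -> F) (i : 'I_n) :
  (lax_mx (\prod_j x j) y *m \col_(k < n) numerator k x y) i 0 =
  (\prod_j y j - \prod_j x j) * prefix_prod x i.
Proof.
rewrite (@lax_mx_mul _ _ _ _ (fun k => numerator k x y)); last first.
  by rewrite numeratorn numerator0 mulrC.
by rewrite numeratorS; ring.
Qed.

(** * Fields of fractions *)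

Lemma frac_reprE (A : idomainType) (r : {fraction A}) :
  r = FracField.tofrac (repr r).1 / FracField.tofrac (repr r).2.
Proof.
have xd := denom_ratioP (repr r).
apply: (canRL (mulfK _)); first by rewrite tofrac_eq0.
rewrite -[X in X * _ = _]reprK !piE; apply/eqmodP.
rewrite /= FracField.equivfE /= /FracField.mulf.
by rewrite !numden_Ratio ?oner_eq0 ?mulf_neq0 ?mulr1 ?oner_neq0 // mulrC.
Qed.

Lemma frac_repr (A : idomainType) (r : {fraction A}) :
  exists2 p : A * A, p.2 != 0 & r = FracField.tofrac p.1 / FracField.tofrac p.2.
Proof. by exists (repr r); [exact: denom_ratioP | exact: frac_reprE]. Qed.

Lemma common_denominator (A : idomainType) (I : finType)
    (r : I -> {fraction A}) :
  exists2 q : A, q != 0 &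
    exists a : I -> A, forall i, q%:F * r i = (a i)%:F.
Proof.
have /fin_all_exists2 [p p0 rE] := fun i => frac_repr (r i).
exists (\prod_i (p i).2); first by apply/prodf_neq0 => i _; exact: p0.
exists (fun i => (p i).1 * \prod_(j | j != i) (p j).2) => i.
rewrite [in LHS](bigD1 i) //= rE !rmorphM /= mulrC mulrA divfK ?tofrac_eq0 //.
Qed.

Section FractionMap.
Variables (A : idomainType) (F : fieldType) (h : {rmorphism A -> F}).
Hypothesis h_inj : forall a, h a = 0 -> a = 0.

(** The extension of an injective morphism h to the field of fractions.  The
    injectivity proof is an argument, so that the morphism structures below can
    be inferred from the term. *)
Definition fracmap & (forall a, h a = 0 -> a = 0) : {fraction A} -> F :=
  fun r => h (repr r).1 / h (repr r).2.
Local Notation fm := (fracmap h_inj).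

Lemma fracmap_neq0 a : a != 0 -> h a != 0.
Proof. by apply: contra_neq; exact: h_inj. Qed.

Lemma fracmapE a b : b != 0 ->
  fm (a%:F / b%:F) = h a / h b.
Proof.
move=> b0; set r := _ / _; have d0 := denom_ratioP (repr r).
have /eqP : r = r by []; rewrite {1}/r [X in _ == X]frac_reprE.
rewrite eqr_div ?tofrac_eq0 // -!rmorphM tofrac_eq => /eqP E.
apply/eqP; rewrite eq_sym eqr_div ?fracmap_neq0 // -!rmorphM.
by rewrite E.
Qed.

Lemma fracmap_tofrac a : fm (FracField.tofrac a) = h a.
Proof.
by rewrite -[X in fm X]divr1 -tofrac1 fracmapE ?oner_neq0 // rmorph1 divr1.
Qed.

Lemma fracmap_zmod_morphism : zmod_morphism fm.
Proof.
move=> r s; have [[p q] /= q0 ->] := frac_repr r.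
have [[p' q'] /= q'0 ->] := frac_repr s.
rewrite -mulNr addf_div ?tofrac_eq0 // -tofracN -!tofracM -tofracD.
rewrite !fracmapE ?mulf_neq0 // -mulNr addf_div ?fracmap_neq0 //.
by rewrite !rmorphD !rmorphM !rmorphN.
Qed.

Lemma fracmap_monoid_morphism : monoid_morphism fm.
Proof.
split=> [|r s]; first by rewrite -tofrac1 fracmap_tofrac rmorph1.
have [[p q] /= q0 ->] := frac_repr r.
have [[p' q'] /= q'0 ->] := frac_repr s.
rewrite mulf_div -!tofracM !fracmapE ?mulf_neq0 //.
by rewrite mulf_div !rmorphM.
Qed.

HB.instance Definition _ :=
  GRing.isZmodMorphism.Build _ _ fm fracmap_zmod_morphism.
HB.instance Definition _ :=
  GRing.isMonoidMorphism.Build _ _ fm fracmap_monoid_morphism.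

End FractionMap.

(** * Semilinear actions given by matrices *)

(** A group G acts on the field K on the right, by pullbacks.  An element which
    fixes the subfield ev(L) and multiplies v, up to a scalar of K, by a matrix
    over L is determined by this matrix, and the matrix is determined by the
    element up to a scalar of L. *)
Section ProjectiveAction.
Variables (G : groupType) (K L : fieldType) (n : nat) (n_gt0 : (0 < n)%N).
Variables (phi : G -> {rmorphism K -> K}) (ev : {rmorphism L -> K}).
Variable v : 'cV[K]_n.
Local Notation i0 := (Ordinal n_gt0).
Implicit Types (f g : G) (A B : 'M[L]_n).

Hypothesis phi1 : forall r, phi 1%g r = r.
Hypothesis phiM : forall f g r, phi (f * g)%g r = phi g (phi f r).

Definition fixes_scalars f := forall a, phi f (ev a) = ev a.

Hypothesis v0 : v i0 0 = 1.
Hypothesis v_generic : forall A (d : K),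
  map_mx ev A *m v = d *: v -> is_scalar_mx A.
Hypothesis phi_faithful : forall f g,
  fixes_scalars f -> fixes_scalars g ->
  map_mx (phi f) v = map_mx (phi g) v -> f = g.

Definition acts f A :=
  fixes_scalars f /\
  exists2 c : K, c != 0 & map_mx (phi f) v = c *: (map_mx ev A *m v).

Lemma map_fixed_mx f A :
  fixes_scalars f -> map_mx (phi f) (map_mx ev A) = map_mx ev A.
Proof. by move=> fl; apply/matrixP => i j; rewrite !mxE fl. Qed.

Lemma acts1 : acts 1%g 1%:M.
Proof.
split; first by move=> a; exact: phi1.
exists 1; rewrite ?oner_neq0 // map_mx1 mul1mx scale1r.
by apply/matrixP => i j; rewrite mxE phi1.
Qed.

Lemma actsM f g A B : acts f A -> acts g B -> acts (f * g)%g (A *m B).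
Proof.
move=> [fl [c c0 fv]] [gl [d d0 gv]].
split; first by move=> a; rewrite phiM fl gl.
exists (phi g c * d); first by rewrite mulf_neq0 // fmorph_eq0.
have -> : map_mx (phi (f * g)%g) v = map_mx (phi g) (map_mx (phi f) v).
  by apply/matrixP => i j; rewrite !mxE phiM.
rewrite fv map_mxZ map_mxM map_fixed_mx //= gv -scalemxAr scalerA map_mxM.
by rewrite mulmxA.
Qed.

Lemma actsV f A : A \in unitmx -> acts f A -> acts f^-1%g (invmx A).
Proof.
move=> Au [fl [c c0 fv]].
have gl : fixes_scalars f^-1%g by move=> a; rewrite -{1}fl -phiM mulgV phi1.
split=> //; exists (phi f^-1%g c)^-1; first by rewrite invr_eq0 fmorph_eq0.
have : map_mx (phi f^-1%g) (map_mx (phi f) v) = v.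
  by apply/matrixP => i j; rewrite !mxE -phiM mulgV phi1.
rewrite fv map_mxZ map_mxM map_fixed_mx //= => {2}<-.
rewrite -scalemxAr scalerA mulVf ?fmorph_eq0 // scale1r mulmxA -map_mxM.
by rewrite mulVmx // map_mx1 mul1mx.
Qed.

Lemma acts_proportional f A B : A \in unitmx -> B \in unitmx ->
  acts f A -> acts f B -> exists2 a, a != 0 & A = a *: B.
Proof.
move=> Au Bu [_ [c c0 fA]] [_ [d d0 fB]].
have : is_scalar_mx (invmx B *m A).
  apply: (@v_generic _ (d / c)); rewrite map_mxM -mulmxA.
  have -> : map_mx ev A *m v = (d / c) *: (map_mx ev B *m v).
    by rewrite mulrC -scalerA -fB fA scalerA mulVf // scale1r.
  by rewrite -scalemxAr mulmxA -map_mxM mulVmx // map_mx1 mul1mx.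
move/is_scalar_mxP => [a aE].
have AE : A = a *: B by rewrite -[A](mulKVmx Bu) aE mul_mx_scalar.
exists a => //; apply: contraTneq Au => a0; rewrite AE a0 scale0r.
by rewrite -row_free_unit /row_free mxrank0 eq_sym -lt0n.
Qed.

Lemma acts_inj f g A B a : acts f A -> acts g B -> A = a *: B -> f = g.
Proof.
move=> [fl [c c0 fA]] [gl [d d0 gB]] AB; apply: phi_faithful => //.
have [e fg] : exists e, map_mx (phi f) v = e *: map_mx (phi g) v.
  exists (c * ev a / d).
  by rewrite gB scalerA divfK // fA AB map_mxZ -scalemxAl scalerA.
rewrite fg; have := congr1 (fun M : 'cV_n => M i0 0) fg.
by rewrite !mxE v0 !rmorph1 mulr1 => <-; rewrite scale1r.
Qed.

Definition represented : set G := [set f | exists A : GL L n, acts f A].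

(** The morphism to PGL, extended by 1 outside the group on which it is
    meaningful. *)
Definition projective_image f : PGL L n :=
  if pselect (represented f) is left fP then \pi_(PGL L n) (sval (cid fP))
  else 1%g.

Lemma projective_imageE f (A : GL L n) :
  acts f A -> projective_image f = \pi_(PGL L n) A.
Proof.
move=> fA; rewrite /projective_image.
case: pselect => [fP|[]]; last by exists A.
case: cid => B fB /=; apply/eqmodP/asboolP.
have [a a0 ->] := acts_proportional (Defs.GL_unit B) (Defs.GL_unit A) fB fA.
by exists a.
Qed.

Lemma projective_imageM :
  {in represented &, {morph projective_image : f g / (f * g)%g}}.
Proof.
move=> f g /set_mem [A fA] /set_mem [B gB].
rewrite (projective_imageE fA) (projective_imageE gB).
rewrite (projective_imageE (A := GL_mul A B)); last exact: actsM.
exact: pi_PGL_mul.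
Qed.

Lemma projective_image_inj : {in represented &, injective projective_image}.
Proof.
move=> f g /set_mem [A fA] /set_mem [B gB].
rewrite (projective_imageE fA) (projective_imageE gB).
by move=> /eqmodP/asboolP [a _ AB]; exact: acts_inj fA gB AB.
Qed.

Lemma represented_subgroup : subgroup represented.
Proof.
split; first by apply/mem_set; exists (GL_one L n); exact: acts1.
move=> f g /set_mem [A fA] /set_mem [B gB]; apply/mem_set.
exists (GL_mul A (GL_inv B)); apply: actsM => //.
exact: actsV (Defs.GL_unit B) gB.
Qed.

End ProjectiveAction.

(** * Generated subgroups and isomorphisms *)

Section SubgroupLemmas.
Local Open Scope classical_set_scope.

Lemma generated_subgroup (G : groupType) (S : set G) : subgroup (generated S).
Proof.
split; first by apply/mem_set => H [[/set_mem H1 _] _].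
move=> f g /set_mem fS /set_mem gS; apply/mem_set => H HP.
have [[_ HV] _] := HP; apply/set_mem/HV; apply/mem_set.
  exact: fS.
exact: gS.
Qed.

Lemma sub_generated (G : groupType) (S : set G) : S `<=` generated S.
Proof. exact: sub_smallest. Qed.

Lemma generated_sub (G : groupType) (S H : set G) :
  subgroup H -> S `<=` H -> generated S `<=` H.
Proof. exact: smallest_sub. Qed.

Lemma generated_inv (G : groupType) (S : set G) :
  generated [set b^-1%g | b in S] = generated S.
Proof.
have sub S' : generated [set b^-1%g | b in S'] `<=` generated S'.
  apply: generated_sub (generated_subgroup S') _ => _ [b Sb <-].
  have /group_closedV V := generated_subgroup S'.
  by apply/set_mem/V/mem_set; exact: sub_generated.
apply/seteqP; split; first exact: sub.
rewrite -{1}[S](_ : [set b^-1%g | b in [set b^-1%g | b in S]] = S).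
  exact: sub.
apply/seteqP; split=> [_ [_ [b Sb <-] <-]|b Sb]; first by rewrite invgK.
by exists b^-1%g; rewrite ?invgK //; exists b.
Qed.

Lemma generated_conj (G : groupType) (S : set G) (h : G) :
  generated [set (b ^ h)%g | b in S] = [set (b ^ h)%g | b in generated S].
Proof.
have conj_sub (T : set G) (k : G) :
    subgroup T -> subgroup [set (b ^ k)%g | b in T].
  move=> [/set_mem T1 TV]; split.
    by apply/mem_set; exists 1%g; rewrite ?conj1g.
  move=> _ _ /set_mem [b Tb <-] /set_mem [c Tc <-]; apply/mem_set.
  exists (b / c)%g; last by rewrite conjMg conjVg.
  by apply/set_mem/TV; apply/mem_set.
apply/seteqP; split.
  apply: generated_sub; first exact/conj_sub/generated_subgroup.
  by move=> _ [b Sb <-]; exists b => //; exact: sub_generated.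
move=> _ [b Sb <-].
have : [set (b ^ h^-1)%g | b in generated [set (b ^ h)%g | b in S]] b.
  apply: generated_sub Sb; first exact/conj_sub/generated_subgroup.
  move=> c Sc; exists (c ^ h)%g; last by rewrite conjgK.
  by apply: sub_generated; exists c.
by move=> [c Sc <-]; rewrite conjgKV.
Qed.

Lemma subgroup_image (G H : groupType) (T S : set G) (f : G -> H) :
  subgroup S -> S `<=` T -> {in T &, {morph f : x y / (x * y)%g}} ->
  subgroup (f @` S).
Proof.
move=> [/set_mem S1 SV] ST fM.
have inT x : S x -> x \in T by move=> Sx; apply/mem_set/ST.
have f1 : f 1%g = 1%g.
  by apply: (mulgI (f 1%g)); rewrite -fM ?inT // !mulg1.
split; first by apply/mem_set; exists 1%g.
move=> _ _ /set_mem [x Sx <-] /set_mem [y Sy <-]; apply/mem_set.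
have Sxy z : S z -> S (x / z)%g by move=> Sz; apply/set_mem/SV; apply/mem_set.
have SVy : S (y^-1)%g.
  by rewrite -[y^-1%g]mul1g; apply/set_mem/SV; apply/mem_set.
exists (x / y)%g; first exact: Sxy.
rewrite fM ?inT //; congr (_ * _)%g.
by apply/esym/mulg1_eq; rewrite -fM ?inT // mulgV.
Qed.

Lemma isomorphic_image (G H : groupType) (T S : set G) (f : G -> H) :
  S `<=` T -> {in T &, injective f} ->
  {in T &, {morph f : x y / (x * y)%g}} -> isomorphic S (f @` S).
Proof.
move=> ST fI fM; have inT x : x \in S -> x \in T.
  by move=> /set_mem Sx; apply/mem_set/ST.
exists f; last by move=> x y xS yS; apply: fM; exact: inT.
by apply: inj_bij => x y xS yS; apply: fI; exact: inT.
Qed.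

Lemma isomorphic_trans (G H J : groupType) (A : set G) (B : set H) (D : set J) :
  isomorphic A B -> isomorphic B D -> isomorphic A D.
Proof.
move=> [f fb fM] [g gb gM]; exists (g \o f); first exact: set_bij_comp fb gb.
have inB x : x \in A -> f x \in B.
  by move=> /set_mem Ax; apply/mem_set; exact: set_bij_homo fb _ Ax.
by move=> x y xA yA /=; rewrite fM // gM // inB.
Qed.

Lemma isomorphic_refl (G : groupType) (A : set G) : isomorphic A A.
Proof. by exists id => //; split=> // x Ax; exists x. Qed.

Lemma isomorphic_conj (G : groupType) (A : set G) (h : G) :
  isomorphic [set (b ^ h)%g | b in A] A.
Proof.
exists (fun b => (b ^ h^-1)%g); last by move=> x y _ _; exact: conjMg.
split=> [_ [b Ab <-]|x y _ _ /conjg_inj //|b Ab]; first by rewrite conjgK.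
by exists (b ^ h)%g; rewrite ?conjgK //; exists b.
Qed.

End SubgroupLemmas.

(** * The function field of the torus over C(t) *)

Section Action.
Variables (C : fieldType) (n : nat).
Hypothesis n_gt0 : (0 < n)%N.
Local Notation K := (ratfun C n).
Local Notation L := {fraction {poly C}}.
Implicit Types (f g : Bir C n) (A B : 'M[L]_n).

Definition gen (i : 'I_n) : K := ('X_i)%:F.

Definition pb f : {rmorphism K -> K} := pullback (bir_dominant f).

Lemma pbE f p q : q != 0 ->
  pb f (p%:F / q%:F) = mmap (@ratcst C n) f p / mmap (@ratcst C n) f q.
Proof. exact: pullbackE. Qed.

Lemma pb_gen f i : pb f (gen i) = f i.
Proof. by rewrite /= pullback_poly mmapX mmap1U. Qed.

Lemma pb_cst f c : pb f (ratcst n c) = ratcst n c.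
Proof. by rewrite /= pullback_poly mmapC. Qed.

Lemma pbM f g r : pb (f * g)%g r = pb g (pb f r).
Proof.
have [p [q [q0 ->]]] := frac_numden r.
rewrite !pbE // fmorph_div.
by congr (_ / _); exact: (mmap_ratcomp (bir_dominant g) f).
Qed.

Lemma pb1 r : pb 1%g r = r.
Proof.
have [p [q [q0 ->]]] := frac_numden r.
by rewrite pbE // !mmap_ratid.
Qed.

Lemma bir_eqP f g : (forall i, pb f (gen i) = pb g (gen i)) -> f = g.
Proof.
by move=> fg; apply/val_inj/ffunP => i; have := fg i; rewrite !pb_gen.
Qed.

(** The coordinates (t, v) of the generic point of the torus: the parameter t
    and the vector spanning the kernel of its cyclic matrix. *)
Definition spectral : K := \prod_i gen i.
Definition kernel_vec : 'cV[K]_n := \col_(k < n) prefix_prod gen k.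

Lemma kernel_vec0 : kernel_vec (Ordinal n_gt0) 0 = 1.
Proof. by rewrite mxE prefix_prod0. Qed.

Lemma gen_neq0 i : gen i != 0.
Proof. by rewrite tofrac_eq0 -msupp_eq0 msuppX. Qed.

(** The substitution of x_1...x_n for t, kept inside the polynomial ring so
    that its values can be specialized. *)
Definition poly_spectral : {rmorphism {poly C} -> {mpoly C[n]}} :=
  horner_morph (fun a => mulrC (\prod_i 'X_i) (@mpolyC n C a)).

(** The specialization at the point x of the torus over C(t) for which v(x) is
    proportional to c and x_1...x_n = t. *)
Definition specialize (c : 'I_n -> L) : {rmorphism {mpoly C[n]} -> L} :=
  let u := cyclic_ext n_gt0 'X%:F c in
  mmap (@FracField.tofrac _ \o polyC) (fun i : 'I_n => u i.+1 / u i).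

Lemma specialize_prefix_prod c k : (forall i, c i != 0) -> (k <= n)%N ->
  specialize c (prefix_prod (fun i => 'X_i) k) =
  cyclic_ext n_gt0 'X%:F c k / c (Ordinal n_gt0).
Proof.
move=> c_nz kn; rewrite prefix_prod_rmorph -(cyclic_ext0 n_gt0 'X%:F).
rewrite -(@prefix_prod_quotients _ n) //; first 1 last.
- by move=> i ni; rewrite (cyclic_ext_ord _ _ _ (Ordinal ni)).
- by rewrite cyclic_ext0.
by apply: eq_bigr => i _; rewrite /= /specialize mmapX mmap1U.
Qed.

Lemma specialize_poly_spectral c p : (forall i, c i != 0) ->
  specialize c (poly_spectral p) = p%:F.
Proof.
move=> c_nz; rewrite /poly_spectral /horner_morph -horner_map -map_poly_comp.
rewrite /= -prefix_prodn specialize_prefix_prod // cyclic_extn cyclic_ext0.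
rewrite mulfK //.
rewrite -[p in RHS]comp_polyXr /comp_poly -horner_map -map_poly_comp.
congr (_.[_]); apply: eq_map_poly => a; exact: mmapC.
Qed.

Lemma poly_spectral_inj p : (poly_spectral p)%:F = 0 -> p = 0.
Proof.
move/eqP; rewrite tofrac_eq0 => /eqP p0; apply/eqP; rewrite -tofrac_eq0.
have nz (i : 'I_n) : (1 : L) != 0 := oner_neq0 _.
by rewrite -(@specialize_poly_spectral (fun=> 1)) // p0 rmorph0.
Qed.

Definition eval_spectral : {rmorphism L -> K} :=
  @fracmap _ _ (@FracField.tofrac _ \o poly_spectral) poly_spectral_inj.

Lemma eval_spectral_poly p : eval_spectral p%:F = (poly_spectral p)%:F.
Proof. exact: fracmap_tofrac. Qed.

Lemma eval_spectralX : eval_spectral 'X%:F = spectral.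
Proof.
by rewrite eval_spectral_poly [poly_spectral _]horner_morphX rmorph_prod.
Qed.

Lemma eval_spectralC a : eval_spectral a%:P%:F = ratcst n a.
Proof. by rewrite eval_spectral_poly [poly_spectral _]horner_morphC. Qed.

Lemma pb_eval_spectral f r : pb f spectral = spectral ->
  pb f (eval_spectral r) = eval_spectral r.
Proof.
move=> fl; have [[p q] /= q0 ->] := frac_repr r.
suff fp s : pb f (poly_spectral s)%:F = (poly_spectral s)%:F.
  have -> : eval_spectral (p%:F / q%:F) =
            (poly_spectral p)%:F / (poly_spectral q)%:F.
    exact: fracmapE.
  by rewrite fmorph_div /= !fp.
have -> : (poly_spectral s)%:F = (map_poly (@ratcst C n) s).[spectral].
  rewrite /poly_spectral /horner_morph -horner_map -map_poly_comp rmorph_prod.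
  by [].
rewrite -horner_map /= fl -map_poly_comp; congr (_.[_]).
by apply: eq_map_poly => a; exact: pb_cst.
Qed.

(** After clearing denominators, v being an eigenvector is a family of
    identities between polynomials in x_1, ..., x_n.  Specializing them to the
    points whose kernel vector is c shows that every vector c over C(t) with
    nonzero entries is an eigenvector of A. *)
Lemma kernel_vec_generic A (d : K) :
  map_mx eval_spectral A *m kernel_vec = d *: kernel_vec -> is_scalar_mx A.
Proof.
move=> Av.
have [q q0 [N NE]] := common_denominator (fun ij : 'I_n * 'I_n => A ij.1 ij.2).
have q'0 : q%:F != 0 by rewrite tofrac_eq0.
pose v k : {mpoly C[n]} := prefix_prod (fun i => 'X_i) k.
have vE (k : 'I_n) : kernel_vec k 0 = (v k)%:F.
  by rewrite mxE /v prefix_prod_rmorph.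
pose w (i : 'I_n) : {mpoly C[n]} := \sum_k poly_spectral (N (i, k)) * v k.
have wE i : (w i)%:F = eval_spectral q%:F * (d * kernel_vec i 0).
  have /matrixP/(_ i 0) := Av; rewrite [X in _ = X]mxE => <-.
  rewrite mxE mulr_sumr rmorph_sum; apply: eq_bigr => k _.
  by rewrite vE mulrA mxE -rmorphM (NE (i, k)) eval_spectral_poly rmorphM.
have wv (i j : 'I_n) : w i * v j = w j * v i.
  apply/eqP; rewrite -tofrac_eq !tofracM !wE !vE; apply/eqP.
  by rewrite !mulrA mulrAC.
have X2 : size ('X^2 : {poly C}) = 3 by rewrite size_polyXn.
have XF (p : {poly C}) : p != 0 -> p%:F != 0 by rewrite tofrac_eq0.
(* t and t^2 are distinct, nonzero and not -1 in every characteristic. *)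
apply: (@scalar_mx_of_eigenvectors _ _ _ 'X%:F ('X^2)%:F).
- by rewrite XF ?polyX_eq0.
- by rewrite XF // -size_poly_eq0 X2.
- rewrite tofrac_eq; apply: contra_eqN X2 => /eqP <-.
  by rewrite size_polyX.
- by rewrite -tofrac1 -rmorphD XF // -size_poly_eq0 addrC size_XaddC.
- by rewrite -tofrac1 -rmorphD XF // -size_poly_eq0 addrC size_XnaddC.
move=> c c_nz i j; pose c' i := c i 0; have c'_nz i0 : c' i0 != 0 := c_nz i0.
have spec_v (k : 'I_n) : specialize c' (v k) = c k 0 / c' (Ordinal n_gt0).
  by rewrite specialize_prefix_prod ?cyclic_ext_ord // ltnW.
have spec_w (k : 'I_n) :
    specialize c' (w k) = q%:F * (A *m c) k 0 / c' (Ordinal n_gt0).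
  rewrite rmorph_sum mxE mulr_sumr mulr_suml; apply: eq_bigr => m _.
  by rewrite rmorphM spec_v specialize_poly_spectral // mulrA mulrA (NE (k, m)).
have := congr1 (specialize c') (wv i j); rewrite !rmorphM !spec_w !spec_v.
set e := c' _ => E; have e0 : e != 0 by exact: c_nz.
have eE (a b : L) : q%:F * a / e * (b / e) = q%:F * (a * b) / e / e.
  by rewrite !mulrA [_ / e * b]mulrAC.
rewrite !eE in E.
by apply: (mulfI q'0); do 2!apply: (mulIf (invr_neq0 e0)).
Qed.

Lemma fixes_scalarsE f :
  fixes_scalars pb eval_spectral f <-> pb f spectral = spectral.
Proof.
split=> [fl|fl a]; last exact: pb_eval_spectral.
by rewrite -eval_spectralX fl.
Qed.

Lemma pb_faithful f g :
    fixes_scalars pb eval_spectral f -> fixes_scalars pb eval_spectral g ->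
  map_mx (pb f) kernel_vec = map_mx (pb g) kernel_vec -> f = g.
Proof.
move=> /fixes_scalarsE fl /fixes_scalarsE gl fg; apply: bir_eqP.
exact: (eq_rmorph_prefix gen_neq0 (etrans fl (esym gl)) fg).
Qed.

End Action.

(** * The reversal of the coordinates *)

Section Reversal.
Variables (C : fieldType) (n : nat).
Local Notation K := (ratfun C n).
Local Notation gen := (@gen C n).

Definition reversal_map : ratmap C n n := [ffun i => gen (rev_ord i)].

Lemma mmap_reversal p :
  mmap (@ratcst C n) reversal_map p = (msym (perm rev_ord_inj) p)%:F.
Proof.
rewrite /msym /mmap rmorph_sum; apply: eq_bigr => a _.
rewrite rmorphM rmorph_prod; congr (_ * _); apply: eq_bigr => i _.
by rewrite ffunE permE rmorphXn.
Qed.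

Lemma reversal_dominant : dominant reversal_map.
Proof.
move=> p; apply: contra_neq; rewrite mmap_reversal => /eqP.
rewrite tofrac_eq0 => /eqP p0; apply: (@inj_msym _ _ (perm rev_ord_inj)).
by rewrite p0 raddf0.
Qed.

Lemma reversalK : ratcomp reversal_map reversal_map = ratid C n.
Proof.
apply/ffunP => i; rewrite !ffunE -/(pullback reversal_dominant _).
by rewrite pullback_poly mmapX mmap1U ffunE rev_ordK.
Qed.

Lemma reversal_birational : birational reversal_map.
Proof.
split; first exact: reversal_dominant.
by exists reversal_map; split; [exact: reversal_dominant|..]; exact: reversalK.
Qed.

Definition reversal : Bir C n := MkBir (asboolT reversal_birational).

Lemma reversal_inv : (reversal^-1)%g = reversal.
Proof. by apply: mulg1_eq; apply/val_inj/reversalK. Qed.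

(** Stated for arbitrary rational maps, because f_z and g_z are compared as
    such, before the birational ones among them are singled out. *)
Lemma reversal_conjE (phi : ratmap C n n) i :
  ratcomp reversal (ratcomp phi reversal) i = pb reversal (phi (rev_ord i)).
Proof.
rewrite ffunE [reversal _]ffunE -[gen _]divr1 -tofrac1.
rewrite ratevalE ?rmorph1 ?oner_neq0 // divr1 mmapX mmap1U.
by rewrite ffunE.
Qed.

Lemma pb_reversal i : pb reversal (gen i) = gen (rev_ord i).
Proof. by rewrite pb_gen ffunE. Qed.

End Reversal.

(** * The maps f_z and g_z *)

(** The next three identities are stated in an abstract field because
    normalizing them in a function field of several variables is costly. *)
Lemma quotient_ratio (F : fieldType) (a b c r : F) :
  a != 0 -> c != 0 -> b / c = a / c * r -> r = b / a.
Proof.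
move=> a0 c0 E; apply: (mulfI (mulf_neq0 a0 (invr_neq0 c0))); rewrite -E.
by field; rewrite a0 c0.
Qed.

Lemma divide_quotient (F : fieldType) (a b r s : F) :
  a != 0 -> b != 0 -> b / a * r = s -> r = s * a / b.
Proof. by move=> a0 b0 <-; field; rewrite a0 b0. Qed.

Lemma cancel_common (F : fieldType) (a b p q t d e : F) :
    b != 0 -> p != 0 -> q != 0 -> t != 0 -> d != 0 -> e != 0 ->
  d * e * (a * p * q / t) / (b * (p * d) * (q * e) / t) = a / b.
Proof. by move=> b0 p0 q0 t0 d0 e0; field; rewrite b0 p0 q0 t0 d0 e0. Qed.

Section Fibres.
Variables (C : fieldType) (n : nat).
Hypothesis n_gt0 : (0 < n)%N.
Variable R : ratmap C (n + n) (n + n).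
Hypothesis R_def : R_spec R.
Local Notation K := (ratfun C n).
Local Notation gen := (@gen C n).
Implicit Types z : 'I_n -> C.

Definition const_pt z : 'I_n -> K := @ratcst C n \o z.

(** The point used for k < n has x_k = 0 and so lies outside the torus, which
    is harmless for polynomials. *)
Lemma numerator_left_neq0 z k : torus z -> (k <= n)%N ->
  numerator k gen (const_pt z) != 0.
Proof.
move=> z_nz; have lt_n (i : 'I_n) : numerator i gen (const_pt z) != 0.
  have -> : numerator i gen (const_pt z) =
            (numerator i (fun j => 'X_j) (@mpolyC n C \o z))%:F.
    by rewrite numerator_rmorph.
  rewrite tofrac_eq0; pose x0 j : C := (j != i)%:R.
  apply: contraTneq (numerator_neq0 (x := x0) z_nz (fun j => erefl)) => /eqP.
  move/eqP/(congr1 (meval x0)); rewrite numerator_rmorph rmorph0.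
  have -> : meval x0 \o (fun j : 'I_n => 'X_j) = x0.
    by apply/funext => j; rewrite /= mevalXU.
  have -> : meval x0 \o (@mpolyC n C \o z) = z.
    by apply/funext => j; rewrite /= mevalC.
  by move=> ->; rewrite eqxx.
rewrite leq_eqVlt => /orP[/eqP ->|kn]; last exact: (lt_n (Ordinal kn)).
rewrite numeratorn mulf_neq0 //.
  by rewrite -numerator0 (lt_n (Ordinal n_gt0)).
by apply/prodf_neq0 => i _; exact: gen_neq0.
Qed.

Lemma reversedK z : reversed (reversed z) = z.
Proof. by apply/funext => i; rewrite /reversed /= rev_ordK. Qed.

Lemma torus_reversed z : torus z -> torus (reversed z).
Proof. by move=> z_nz i; exact: z_nz. Qed.

Lemma pb_reversal_gen : pb (reversal C n) \o gen = reversed gen.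
Proof. by apply/funext => i; rewrite [LHS]pb_reversal. Qed.

Lemma pb_reversal_cst z :
  pb (reversal C n) \o const_pt (reversed z) = reversed (const_pt z).
Proof. by apply/funext => i; rewrite [LHS]pb_cst. Qed.

Lemma const_pt_neq0 z i : torus z -> const_pt z i != 0.
Proof. by move=> z_nz; rewrite fmorph_eq0. Qed.

Lemma numerator_right z k : torus z -> (k <= n)%N ->
  numerator k (const_pt z) gen =
  pb (reversal C n) (numerator (n - k) gen (const_pt (reversed z)))
    * prefix_prod (const_pt z) k * prefix_prod gen k / \prod_i gen i.
Proof.
move=> z_nz kn; rewrite numerator_rmorph pb_reversal_gen pb_reversal_cst.
rewrite numerator_rev // mulfK //; apply/prodf_neq0 => i _; exact: gen_neq0.
Qed.

Lemma numerator_right_neq0 z k : torus z -> (k <= n)%N ->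
  numerator k (const_pt z) gen != 0.
Proof.
move=> z_nz kn; have gen_nz := @gen_neq0 C n.
have rz_nz : torus (reversed z) by move=> i; exact: z_nz.
have pc : prefix_prod (const_pt z) k != 0.
  by apply: prefix_prod_neq0 => i; exact: const_pt_neq0.
have pg : prefix_prod gen k != 0 by exact: prefix_prod_neq0.
have G0 : \prod_i gen i != 0 by apply/prodf_neq0 => i _; exact: gen_nz.
have N0 :
    pb (reversal C n) (numerator (n - k) gen (const_pt (reversed z))) != 0.
  by rewrite fmorph_eq0; apply: numerator_left_neq0 => //; exact: leq_subr.
rewrite (numerator_right z_nz kn); apply: mulf_neq0; last first.
  by rewrite invr_eq0; exact: G0.
by apply: mulf_neq0 pg; apply: mulf_neq0 pc.
Qed.

Let x i : {mpoly C[n + n]} := 'X_(lshift n i).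
Let y i : {mpoly C[n + n]} := 'X_(rshift n i).

Lemma mmap_numerator (u v : 'I_n -> K) k :
  mmap (@ratcst C n) (pair_point u v) (numerator k x y) = numerator k u v.
Proof.
rewrite numerator_rmorph; congr numerator; apply/funext => i;
  rewrite /= /x /y mmapX mmap1U /pair_point.
- by rewrite (unsplitK (inl i)).
- by rewrite (unsplitK (inr i)).
Qed.

Lemma numerator_neq0_xy k : (k <= n)%N -> numerator k x y != 0.
Proof.
move=> kn; have one_torus : torus (fun _ : 'I_n => 1 : C).
  by move=> i; exact: oner_neq0.
apply: contraTneq (numerator_left_neq0 one_torus kn) => n0.
by rewrite -mmap_numerator n0 rmorph0 eqxx.
Qed.

(** The defining equations give the products x'_1...x'_k; recovering x'_i by
    division requires the numerators to be nonzero, which is checked at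
    y = (1, ..., 1). *)
Lemma R_prefix k : (k <= n)%N ->
  prefix_prod (fun i => R (lshift n i)) k =
  (numerator k x y)%:F / (numerator 0 x y)%:F.
Proof.
have num_nz j : (j <= n)%N -> (numerator j x y)%:F != 0.
  by move=> jn; rewrite tofrac_eq0 numerator_neq0_xy.
case: k => [|k] kn; first by rewrite prefix_prod0 divff ?num_nz.
have [/(_ k.+1 kn) + _] := R_def.
have D0 := num_nz 0 (leq0n n); rewrite numerator0 in D0 *.
rewrite {1}/prefix_prod => ->; rewrite numerator_rmorph.
rewrite /numerator mulrDl deltaR_rmorph in D0 *.
by rewrite mulfK // /eta mulrA.
Qed.

Lemma R_left i :
  R (lshift n i) = (numerator i.+1 x y)%:F / (numerator i x y)%:F.
Proof.
have num_nz j : (j <= n)%N -> (numerator j x y)%:F != 0.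
  by move=> jn; rewrite tofrac_eq0 numerator_neq0_xy.
have := prefix_prodS (fun i => R (lshift n i)) i.
rewrite !R_prefix // 1?ltnW //.
have ai := num_nz i (ltnW (ltn_ord i)); have a0 := num_nz 0%N (leq0n n).
move=> E; exact: (quotient_ratio ai a0 E).
Qed.

Lemma R_right i :
  R (rshift n i) =
  (x i * y i * numerator i x y)%:F / (numerator i.+1 x y)%:F.
Proof.
have num_nz j : (j <= n)%N -> (numerator j x y)%:F != 0.
  by move=> jn; rewrite tofrac_eq0 numerator_neq0_xy.
have [_ /(_ i)] := R_def; rewrite R_left.
have ai := num_nz i (ltnW (ltn_ord i)); have aS := num_nz i.+1 (ltn_ord i).
move=> E; rewrite 2!tofracM; exact: (divide_quotient ai aS E).
Qed.

Lemma R_fE z i : torus z ->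
  R_f R z i = numerator i.+1 gen (const_pt z) / numerator i gen (const_pt z).
Proof.
move=> z_nz; have gid : ratid C n = gen :> (_ -> _).
  by apply/funext => j; rewrite ffunE.
have E := mmap_numerator gen (const_pt z).
rewrite ffunE R_left gid ratevalE.
  exact: (congr2 _ (E _) (congr1 _ (E _))).
rewrite E.
exact: (numerator_left_neq0 z_nz (ltnW (ltn_ord i))).
Qed.

Lemma R_gE z i : torus z ->
  R_g R z i =
  const_pt z i * gen i * numerator i (const_pt z) gen
    / numerator i.+1 (const_pt z) gen.
Proof.
move=> z_nz; have gid : ratid C n = gen :> (_ -> _).
  by apply/funext => j; rewrite ffunE.
rewrite ffunE R_right gid ratevalE mmap_numerator; last first.
  exact: (numerator_right_neq0 z_nz (ltn_ord i)).
rewrite !rmorphM /= mmap_numerator /x /y !mmapX !mmap1U /pair_point.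
by rewrite (unsplitK (inl i)) (unsplitK (inr i)).
Qed.

(** Both sides are quotients of consecutive numerators; numerator_right
    exchanges the constant argument with the generic one at the cost of
    monomial factors, which leave x_i y_i in the quotient. *)
Lemma R_g_reversal z : torus z ->
  R_g R z =
  ratcomp (reversal C n) (ratcomp (R_f R (reversed z)) (reversal C n)).
Proof.
move=> z_nz; have rz_nz : torus (reversed z) by move=> i; exact: z_nz.
apply/ffunP => i.
rewrite (R_gE i z_nz) reversal_conjE (R_fE (rev_ord i) rz_nz).
rewrite (numerator_right z_nz (ltnW (ltn_ord i))).
rewrite (numerator_right z_nz (ltn_ord i)) !prefix_prodS fmorph_div.
have -> : (rev_ord i).+1 = (n - i)%N by rewrite /= subnSK.
set a := pb _ _; set b := pb _ _.
have gen_nz := @gen_neq0 C n.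
have ci : const_pt z i != 0 by exact: const_pt_neq0.
have pc : prefix_prod (const_pt z) i != 0.
  by apply: prefix_prod_neq0 => j; exact: const_pt_neq0.
have pg : prefix_prod gen i != 0 by exact: prefix_prod_neq0.
have G0 : \prod_j gen j != 0 by apply/prodf_neq0 => j _; exact: gen_nz.
have b0 : b != 0.
  rewrite fmorph_eq0; apply: (numerator_left_neq0 rz_nz).
  exact: leq_subr.
have gi := gen_nz i.
exact: (cancel_common a b0 pc pg G0 ci gi).
Qed.

Lemma R_f_reversal z : torus z ->
  R_f R z =
  ratcomp (reversal C n) (ratcomp (R_g R (reversed z)) (reversal C n)).
Proof.
move=> z_nz; rewrite R_g_reversal; last by move=> i; exact: z_nz.
rewrite reversedK.
apply/ffunP => i; rewrite !reversal_conjE rev_ordK -pbM.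
by rewrite -{1}reversal_inv mulVg pb1.
Qed.

Definition f_generators : set (Bir C n) :=
  [set b : Bir C n | exists2 z, torus z & bir_map b = R_f R z]%classic.
Definition g_generators : set (Bir C n) :=
  [set b : Bir C n | exists2 z, torus z & bir_map b = R_g R z]%classic.

(** Conjugation by rho exchanges f_z with g_(rho z) as rational maps, hence
    exchanges the birational ones among them. *)
Lemma g_generatorsE :
  g_generators = [set (b ^ reversal C n)%g | b in f_generators]%classic.
Proof.
have bir_conj (b : Bir C n) :
    bir_map (b ^ reversal C n)%g =
    ratcomp (reversal C n) (ratcomp b (reversal C n)).
  by rewrite /conjg reversal_inv.
apply/seteqP; split=> [b [z z_nz bz]|_ [b [z z_nz bz] <-]].
  exists (b ^ reversal C n)%g; last by rewrite -{1}reversal_inv conjgKV.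
  exists (reversed z); first exact: torus_reversed.
  by rewrite bir_conj bz (R_f_reversal (torus_reversed z_nz)) reversedK.
exists (reversed z); first exact: torus_reversed.
by rewrite bir_conj bz (R_g_reversal (torus_reversed z_nz)) reversedK.
Qed.

(** * The embedding in PGL *)

Local Notation L := {fraction {poly C}}.
Local Notation ev := (eval_spectral C n_gt0).
Local Notation acts := (acts (@pb C n) ev (kernel_vec C n)).

Lemma spectral_nonconstant (a : C) : 'X%:F != a%:P%:F :> L.
Proof.
rewrite tofrac_eq; apply: contraFneq (_ : size (a%:P) == 2 = false) => [<-|].
  by rewrite size_polyX.
by rewrite size_polyC; case: (_ != 0).
Qed.

Definition generator_mx z : 'M[L]_n :=
  lax_mx 'X%:F (fun i => (z i)%:P%:F).

Lemma generator_mx_unit z : generator_mx z \in unitmx.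
Proof.
apply: lax_mx_unit => //; rewrite -!rmorph_prod; exact: spectral_nonconstant.
Qed.

Lemma map_generator_mx z :
  map_mx ev (generator_mx z) = lax_mx (\prod_i gen i) (const_pt z).
Proof.
rewrite map_lax_mx eval_spectralX; congr lax_mx; apply/funext => i.
exact: eval_spectralC.
Qed.

(** The pullback of v under f_z is proportional to the vector u of numerators,
    and numerator_lax reads L_z(t) u = (z_1...z_n - t) v. *)
Lemma R_f_acts (b : Bir C n) z : torus z -> bir_map b = R_f R z ->
  acts b (invmx (generator_mx z)).
Proof.
move=> z_nz bE; pose u k := numerator k gen (const_pt z).
have u_nz k : (k <= n)%N -> u k != 0 by exact: numerator_left_neq0.
have b_prefix k : (k <= n)%N -> pb b (prefix_prod gen k) = u k / u 0.
  move=> kn; rewrite prefix_prod_rmorph -(prefix_prod_quotients _ _ kn).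
  - by apply: eq_bigr => i _; rewrite [LHS]pb_gen bE R_fE.
  - by move=> i ni; rewrite u_nz // ltnW.
  - exact: u_nz.
split.
  apply/fixes_scalarsE; rewrite /spectral -prefix_prodn b_prefix //.
  have D0 : deltaR n gen (const_pt z) != 0 by rewrite -numerator0; exact: u_nz.
  by rewrite /u numeratorn numerator0 mulrAC (mulfV D0) mul1r prefix_prodn.
pose d := \prod_j const_pt z j - \prod_j gen j.
have bu : map_mx (pb b) (kernel_vec C n) = (u 0)^-1 *: \col_(k < n) u k.
  by apply/colP => k; rewrite !mxE b_prefix 1?ltnW // mulrC.
have Lu : map_mx ev (generator_mx z) *m \col_(k < n) u k = d *: kernel_vec C n.
  by apply/colP => k; rewrite map_generator_mx numerator_lax !mxE.
exists ((u 0)^-1 * d).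
  rewrite mulf_neq0 ?invr_eq0 ?u_nz //.
  have -> : d = ev ((\prod_i z i)%:P%:F - 'X%:F).
    by rewrite rmorphB /= eval_spectralX eval_spectralC rmorph_prod.
  by rewrite fmorph_eq0 subr_eq0 eq_sym spectral_nonconstant.
rewrite bu -scalerA; congr (_ *: _); rewrite scalemxAr.
rewrite -Lu mulmxA -map_mxM mulVmx ?generator_mx_unit //.
by rewrite map_mx1 mul1mx.
Qed.

Local Open Scope classical_set_scope.

(** Both subgroups of PGL are taken to be the image of G^+, to which G^- is
    conjugate. *)
Lemma reduced_groups_embed :
  exists Hp Hm : set (PGL L n),
    [/\ subgroup Hp, subgroup Hm,
        isomorphic (reduced_plus R) Hp,
        isomorphic (reduced_minus R) Hm &
        isomorphic Hp Hm].
Proof.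
pose T := represented (@pb C n) ev (kernel_vec C n).
pose P := projective_image (@pb C n) ev (kernel_vec C n).
have PM : {in T &, {morph P : f g / (f * g)%g}}.
  by apply: (projective_imageM n_gt0); [exact: pbM|exact: kernel_vec_generic].
have PI : {in T &, injective P}.
  apply: (projective_image_inj (n_gt0 := n_gt0)).
  - exact: kernel_vec0.
  - exact: kernel_vec_generic.
  - exact: pb_faithful.
have Tsub : subgroup T by apply: represented_subgroup; [exact: pb1|exact: pbM].
have plusE : reduced_plus R = generated f_generators by exact: generated_inv.
have minusE : reduced_minus R =
    [set (b ^ reversal C n)%g | b in reduced_plus R].
  rewrite plusE -generated_conj; exact: (congr1 _ g_generatorsE).
have plusT : reduced_plus R `<=` T.
  rewrite plusE; apply: generated_sub Tsub _ => b [z z_nz bz].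
  have Lu : invmx (generator_mx z) \in unitmx.
    by rewrite unitmx_inv generator_mx_unit.
  by exists (MkGL Lu); exact: R_f_acts.
have isoP := isomorphic_image plusT PI PM.
have subP : subgroup (P @` reduced_plus R).
  by apply: subgroup_image plusT PM; rewrite plusE; exact: generated_subgroup.
exists (P @` reduced_plus R), (P @` reduced_plus R); split=> //.
  by apply: isomorphic_trans isoP; rewrite minusE; exact: isomorphic_conj.
exact: isomorphic_refl.
Qed.

End Fibres.

Local Open Scope classical_set_scope.

Theorem proposition3p5 (K : realType) (n : nat) (n_ge1 : (1 <= n)%N)
    (R : ratmap K[i] (n + n) (n + n)) (R_def : R_spec R) :
  exists Hp Hm : set (PGL {fraction {poly K[i]}} n),
    [/\ subgroup Hp, subgroup Hm,
        isomorphic (reduced_plus R) Hp,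
        isomorphic (reduced_minus R) Hm &
        isomorphic Hp Hm].
Proof. exact: (reduced_groups_embed n_ge1 R_def). Qed.
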